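(* Let $\Lambda=\{\Lambda_\omega\in B(\mathcal{H},\mathcal{K}_\omega):\omega\in\Omega\}$ be a continuous $g$-frame with lower and upper bounds $A_\Lambda,B_\Lambda$, and let $\Theta=\{\Theta_\omega\in B(\mathcal{H},\mathcal{K}_\omega):\omega\in\Omega\}$ be a family of operators such that for each $f\in\mathcal{H}$, $\{\Theta_\omega f\}_{\omega\in\Omega}$ is strongly measurable and there exists $\nu\in[0,\frac{A_\Lambda^2}{B_\Lambda})$ such that $$\int_\Omega\|(\Lambda_\omega-\Theta_\omega)f\|^2\,d\mu(\omega)\le\nu\|f\|^2,\quad f\in\mathcal{H}.$$ Suppose $m\in L^\infty(\Omega,\mu)$ is such that for some positive constant $\delta$ we have $m(\omega)\ge\delta>0$ a.e. and $\frac{\|m\|_\infty}{\delta}\sqrt{\nu}<\frac{A_\Lambda}{\sqrt{B_\Lambda}}$. Then $M_{m,\Lambda,\Theta}\in GL(\mathcal{H})$ and $$\frac{1}{\|m\|_\infty B_\Lambda+\|m\|_\infty\sqrt{\nu B_\Lambda}}\|f\|\le\|M_{m,\Lambda,\Theta}^{-1}f\|\le\frac{1}{\delta A_\Lambda-\|m\|_\infty\sqrt{\nu B_\Lambda}}\|f\|,\quad f\in\mathcal{H},$$ and $$M_{m,\Lambda,\Theta}^{-1}=\sum_{k=0}^\infty\big[S_{\sqrt{m}\Lambda}^{-1}(S_{\sqrt{m}\Lambda}-M_{m,\Lambda,\Theta})\big]^kS_{\sqrt{m}\Lambda}^{-1},$$ where, for all $n\in\mathbb{N}$, $$\Big\|M_{m,\Lambda,\Theta}^{-1}-\sum_{k=0}^n\big[S_{\sqrt{m}\Lambda}^{-1}(S_{\sqrt{m}\Lambda}-M_{m,\Lambda,\Theta})\big]^kS_{\sqrt{m}\Lambda}^{-1}\Big\|\le\Big(\frac{\|m\|_\infty\sqrt{\nu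 B_\Lambda}}{\delta A_\Lambda}\Big)^{n+1}\frac{1}{\delta A_\Lambda-\|m\|_\infty\sqrt{\nu B_\Lambda}}.$$
   Context: $(\Omega,\mu)$ is a measure space with positive measure $\mu$, $\mathcal{H}$ is a Hilbert space, $\{\mathcal{K}_\omega:\omega\in\Omega\}$ is a family of Hilbert spaces, $B(\mathcal{H},\mathcal{K}_\omega)$ is the space of bounded linear operators, and $GL(\mathcal{H})$ is the set of all invertible bounded linear operators on $\mathcal{H}$. An element $F\in\prod_{\omega\in\Omega}\mathcal{K}_\omega$ is strongly measurable if $F$, as a mapping of $\Omega$ to $\bigoplus_{\omega\in\Omega}\mathcal{K}_\omega$, is measurable. A family $\Lambda=\{\Lambda_\omega\in B(\mathcal{H},\mathcal{K}_\omega):\omega\in\Omega\}$ is a continuous $g$-frame for $\mathcal{H}$ with respect to $\{\mathcal{K}_\omega\}$ if (a) for each $f\in\mathcal{H}$, $\{\Lambda_\omega f:\omega\in\Omega\}$ is strongly measurable, and (b) there are constants $0<A_\Lambda\le B_\Lambda<\infty$ (lower and upper continuous $g$-frame bounds) with $A_\Lambda\|f\|^2\le\int_\Omega\|\Lambda_\omega f\|^2\,d\mu(\omega)\le B_\Lambda\|f\|^2$ for all $f\in\mathcal{H}$. It is a continuous $g$-Bessel family if (a) holds and the right-hand inequality in (b) holds for all $f\in\mathcal{H}$. The continuous $g$-frame operator of a continuous $g$-frame $\Lambda$ is the positive invertible operator $S_\Lambda$ on $\mathcal{H}$ with $\langle S_\Lambda f,g\rangle=\int_\Omega\langle\Lambda_\omega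 f,\Lambda_\omega g\rangle\,d\mu(\omega)$ for $f,g\in\mathcal{H}$. Here $\sqrt{m}\Lambda=\{\sqrt{m(\omega)}\Lambda_\omega\in B(\mathcal{H},\mathcal{K}_\omega):\omega\in\Omega\}$, so $\langle S_{\sqrt{m}\Lambda}f,g\rangle=\int_\Omega m(\omega)\langle\Lambda_\omega f,\Lambda_\omega g\rangle\,d\mu(\omega)$. $M_{m,\Lambda,\Theta}:\mathcal{H}\to\mathcal{H}$ denotes the operator defined by $\langle M_{m,\Lambda,\Theta}f,g\rangle=\int_\Omega m(\omega)\langle\Theta_\omega f,\Lambda_\omega g\rangle\,d\mu(\omega)$ for $f,g\in\mathcal{H}$, whenever this formula defines a bounded operator (in particular whenever $\Lambda,\Theta$ are continuous $g$-Bessel families and $m\in L^\infty(\Omega,\mu)$). *)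

(* Defs.v *)
From HB Require Import structures.
From mathcomp Require Import all_boot all_order all_algebra sesquilinear.
From mathcomp Require Import complex.
From mathcomp Require Import all_classical all_reals all_analysis.

Set Implicit Arguments.
Unset Strict Implicit.
Unset Printing Implicit Defensive.

Import Order.TTheory GRing.Theory Num.Theory.
Import numFieldNormedType.Exports.

Local Open Scope classical_set_scope.
Local Open Scope ring_scope.

(* Complex Hilbert spaces: [inner] is linear in its first argument and
   conjugate-linear in the second. *)
HB.mixin Record isHilbert (R : realType) H
    & CompleteNormedModule R[i] H := {
  inner : {dot H for (@Num.conj R[i])};
  norm_inner : forall x : H, `|x| ^+ 2 = inner x x
}.

#[short(type="hilbertType")]
HB.structure Definition Hilbert (R : realType) :=
  {H of CompleteNormedModule R[i] H & isHilbert R H}.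

(* The norm of a normed module over [R[i]] is itself a (nonnegative real)
   element of [R[i]]; [hnorm] is the same number in [R]. *)
Definition hnorm (R : realType) (H : hilbertType R) (x : H) : R :=
  complex.Re `|x|.

(* Bounded operators: a linear map between normed spaces is bounded iff it is
   continuous (linear_bounded_continuous). *)
#[short(type="boundedOp")]
HB.structure Definition BoundedOperator (R : realType) (H K : hilbertType R) :=
  {T of @GRing.Linear R[i] H K *:%R T & @isContinuous H K T}.

Section scale_bounded.
Context (R : realType) (H K : hilbertType R) (c : R[i]) (T : boundedOp H K).

Lemma scale_op_continuous : continuous (c \*: T).
Proof. by move=> x; apply: cvgZl_tmp; exact: cts_fun. Qed.

HB.instance Definition _ :=
  @isContinuous.Build H K (c \*: T) scale_op_continuous.

Definition scale_op : boundedOp H K := c \*: T.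
End scale_bounded.

Definition inverse_op (R : realType) (H : hilbertType R) (T T' : boundedOp H H) :=
  cancel T T' /\ cancel T' T.

(* Extended-real valued, so that an unbounded map has norm +oo. *)
Definition opnorm (R : realType) (H : hilbertType R) (T : H -> H) : \bar R :=
  ereal_sup [set (hnorm (T f))%:E | f in [set f | hnorm f <= 1]].

Section direct_sum.
Context (R : realType) (I : choiceType) (K : I -> hilbertType R).

Definition sqnorm_sum (x : forall i, K i) : \bar R :=
  (\esum_(i in [set: I]) (hnorm (x i) ^+ 2)%:E)%E.

Record direct_sum := DirectSum {
  dsval :> forall i, K i;
  dsvalP : (sqnorm_sum dsval < +oo)%E
}.

Definition dsball (x : direct_sum) (e : R) : set direct_sum :=
  [set y | (sqnorm_sum (fun i => x i - y i)%R < (e ^+ 2)%:E)%E].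

Definition dsopen (U : set direct_sum) :=
  forall x, U x -> exists2 e : R, 0 < e & dsball x e `<=` U.

Definition single i (v : K i) : forall j, K j := dfwith (fun j => 0 : K j) i v.

Lemma single_summable i (v : K i) : (sqnorm_sum (single v) < +oo)%E.
Proof.
rewrite /sqnorm_sum /single (esumID [set i]); last by move=> *; rewrite lee_fin sqr_ge0.
rewrite setTI esum_set1 ?lee_fin ?sqr_ge0// esum1 ?adde0 ?ltry// => j [_ /= ij].
rewrite dfwithout; last by apply/eqP => ji; apply: ij.
by rewrite /hnorm normr0 expr0n.
Qed.

Definition ds_inj i (v : K i) : direct_sum := DirectSum (single_summable v).

End direct_sum.

(* An element F of the product of the K w, seen as the map w |-> F w from Omega
   to the Hilbert direct sum of the K w, is Borel measurable. *)
Definition strongly_measurable d (T : measurableType d) (R : realType)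
    (K : T -> hilbertType R) (F : forall w, K w) :=
  forall U : set (direct_sum K), <<s @dsopen R T K >> U ->
    measurable [set w | U (ds_inj (F w))].

Section gframes.
Local Open Scope ereal_scope.
Context d (T : measurableType d) (R : realType) (mu : {measure set T -> \bar R}).
Context (H : hilbertType R) (K : T -> hilbertType R).
Implicit Types (m : T -> R) (A B : R) (L Th : forall w, boundedOp H (K w)).

Definition continuous_gframe A B L :=
  [/\ forall f, strongly_measurable (fun w => L w f),
      (0 < A)%R, (A <= B)%R &
      forall f, (A * hnorm f ^+ 2)%:E <= \int[mu]_w (hnorm (L w f) ^+ 2)%:E
                <= (B * hnorm f ^+ 2)%:E].

Definition cintegrable (F : T -> R[i]) :=
  mu.-integrable setT (EFin \o (fun w => complex.Re (F w))) /\
  mu.-integrable setT (EFin \o (fun w => complex.Im (F w))).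

Definition cintegral (F : T -> R[i]) : R[i] :=
  Complex (\int[mu]_w complex.Re (F w))%R (\int[mu]_w complex.Im (F w))%R.

Definition is_multiplier m L Th (M : boundedOp H H) := forall f g,
  let F w := ((m w)%:C%C * inner (Th w f) (L w g))%R in
  cintegrable F /\ inner (M f) g = cintegral F.

Definition is_frame_operator L (S : boundedOp H H) :=
  [/\ forall f g, let F w := inner (L w f) (L w g) in
        cintegrable F /\ inner (S f) g = cintegral F,
      forall f, (0 <= inner (S f) f)%R
    & exists S', inverse_op S S'].

Definition sqrt_weighted m L : forall w, boundedOp H (K w) :=
  fun w => scale_op ((Num.sqrt (m w))%:C%C)%R (L w).

Definition Linfty_norm m : R := fine 'N[mu]_+oo[EFin \o m].

End gframes.

Definition neumann_sum (R : realType) (H : hilbertType R)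
    (S S' M : boundedOp H H) (n : nat) : H -> H :=
  fun f => \sum_(k < n.+1) iter k (fun h => S' (S h - M h)) (S' f).

(* Main.v *)
Require Import Defs.
From HB Require Import structures.
From mathcomp Require Import all_boot all_order all_algebra complex sesquilinear.
From mathcomp Require Import all_classical all_reals all_analysis.
From mathcomp Require Import measurable_realfun ess_sup_inf ring lra.
Set Implicit Arguments.
Unset Strict Implicit.
Unset Printing Implicit Defensive.
Import Order.TTheory GRing.Theory Num.Theory.
Import numFieldNormedType.Exports.
Local Open Scope classical_set_scope.
Local Open Scope ring_scope.

(** Only the real part of the inner product matters, since the imaginary part of
    [<f, g>] is the real part of [<f, i g>]. Write [L] and [Th] for the two families
    of operators, [S] for the frame operator of [sqrt m L] and [M] for the
    multiplier.

    The lower frame bound and [m >= delta] give [<S f, f> >= delta A |f|^2], so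
    [S] is coercive ([rdot_S_ge]). The difference [S - M] is represented by the
    form [int m <(L - Th) f, L g>], and Cauchy-Schwarz, first pointwise and then
    for integrals, gives [|S - M| <= |m| sqrt (nu B)] ([hnorm_subSM_le]). The
    smallness hypothesis says exactly that this is less than [delta A].
    Therefore [M] is coercive too, with constant [delta A - |m| sqrt (nu B)]
    ([rdot_M_ge]). A coercive bounded operator on a Hilbert space has a bounded
    inverse, of norm at most the inverse of the coercivity constant
    ([lax_milgram]); this produces both inverses and the upper bound for
    [M^-1], while the lower bound for [M^-1] is the upper bound
    [|M| <= |S| + |S - M|] ([hnorm_M_le]) applied to [M^-1 f].

    For the series, [E = S^-1 (S - M)] satisfies [1 - E = S^-1 M], so the
    remainder of the partial sum of order [n] is exactly [E^(n+1) M^-1]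
    ([neumann_remainder]). As [|E| <= |m| sqrt (nu B) / (delta A) < 1], this
    yields the error estimate, and with it the convergence.

    Two ingredients lie behind the existence of [M] and [S]. The first is the
    Riesz representation theorem, proved together with Lax-Milgram by
    minimising a quadratic functional ([gram_form_representation]). The second
    is the measurability of the integrands: in the direct sum of all the [K w],
    a strongly measurable family has the property that every subset of the set
    where it does not vanish is measurable ([strongly_measurable_subsupport]),
    so that any function vanishing wherever [L w g] does is measurable. *)

(** * The real inner product underlying a complex Hilbert space *)

Section real_inner_product.
Context (R : realType) (H : hilbertType R).
Implicit Types (f g h : H) (t : R).

(** Real parts carry all the information of the complex inner product (see
    [inner_ext]), and Cauchy-Schwarz, minimisation and integral estimates are
    simpler for the real-valued form. *)
Definition rdot f g : R := complex.Re (inner f g).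

Lemma ReD (x y : R[i]) : complex.Re (x + y) = complex.Re x + complex.Re y.
Proof. by case: x y => [a b] [c e]. Qed.

Lemma rdotDl f g h : rdot (f + g) h = rdot f h + rdot g h.
Proof. by rewrite /rdot linearDl ReD. Qed.

Lemma inner_conj f g : inner g f = (inner f g)^*%C.
Proof. by rewrite (hermC inner) expr0 mul1r. Qed.

Lemma rdotC f g : rdot f g = rdot g f.
Proof. by rewrite /rdot [inner f g]inner_conj; case: (inner g f). Qed.

Lemma rdotDr f g h : rdot h (f + g) = rdot h f + rdot h g.
Proof. by rewrite rdotC rdotDl ![rdot _ h]rdotC. Qed.

Lemma rdotZ (c : R[i]) f g : rdot (c *: f) g = rdot f (c^*%C *: g).
Proof.
rewrite /rdot linearZl_LR linearZr_LR /=; congr (complex.Re (_ * _)).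
by rewrite [RHS]conjCK.
Qed.

Lemma rdotZl t f g : rdot (t%:C%C *: f) g = t * rdot f g.
Proof.
by rewrite /rdot linearZl_LR /=; case: (inner f g) => a b /=; rewrite mul0r subr0.
Qed.

Lemma rdotZr t f g : rdot f (t%:C%C *: g) = t * rdot f g.
Proof. by rewrite rdotC rdotZl rdotC. Qed.

(** Conjugate-linearity in the second argument turns multiplication by [i] there
    into multiplication by [-i], which moves the imaginary part to the real
    part. *)
Lemma Im_inner f g : complex.Im (inner f g) = rdot f ('i%C *: g).
Proof.
by rewrite /rdot linearZr_LR /=; case: (inner f g) => a b /=; rewrite mul0r mulN1r opprK add0r.
Qed.

Lemma inner_ext (z : R[i]) f g :
  rdot f g = complex.Re z -> rdot f ('i%C *: g) = complex.Im z -> inner f g = z.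
Proof.
by rewrite -Im_inner /rdot; case: z (inner f g) => a b [c e] /= -> ->.
Qed.

Lemma normr_hnorm f : `|f| = (hnorm f)%:C%C.
Proof. by rewrite /hnorm RRe_real// normr_real. Qed.

Lemma hnorm_ge0 f : 0 <= hnorm f.
Proof. by have := normr_ge0 f; rewrite normr_hnorm lecR. Qed.

Lemma hnorm_sqr f : hnorm f ^+ 2 = rdot f f.
Proof. by rewrite /rdot -norm_inner normr_hnorm -rmorphXn. Qed.

Lemma rdot_ge0 f : 0 <= rdot f f.
Proof. by rewrite -hnorm_sqr sqr_ge0. Qed.

Lemma hnorm_eq0 f : (hnorm f == 0) = (f == 0).
Proof. by rewrite -(normr_eq0 f) normr_hnorm (inj_eq (@complexI _)). Qed.

Lemma hnorm0 : hnorm (0 : H) = 0. Proof. by apply/eqP; rewrite hnorm_eq0. Qed.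

Lemma hnormN f : hnorm (- f) = hnorm f.
Proof. by rewrite /hnorm normrN. Qed.

Lemma hnormD f g : hnorm (f + g) <= hnorm f + hnorm g.
Proof. by rewrite -lecR rmorphD /= -!normr_hnorm ler_normD. Qed.

Lemma rdotNl f g : rdot (- f) g = - rdot f g.
Proof. by rewrite /rdot linearNl /=; move: (inner f g) => [a b]. Qed.

Lemma rdotBl f g h : rdot (f - g) h = rdot f h - rdot g h.
Proof. by rewrite rdotDl rdotNl. Qed.

Lemma rdotBr f g h : rdot h (f - g) = rdot h f - rdot h g.
Proof. by rewrite rdotC rdotBl ![rdot _ h]rdotC. Qed.

Lemma rdot_inj f g : (forall h, rdot f h = rdot g h) -> f = g.
Proof.
move=> fg; apply/eqP; rewrite -subr_eq0 -hnorm_eq0 -sqrf_eq0 hnorm_sqr rdotBl fg.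
by rewrite subrr.
Qed.

(** Expand [0 <= | |g| f - |f| g |^2]; the cross term has coefficient
    [2 |f| |g|], which can be divided out. *)
Lemma rdot_cauchy_schwarz f g : rdot f g <= hnorm f * hnorm g.
Proof.
have [->|g0] := eqVneq g 0.
  by rewrite hnorm0 mulr0 rdotC -(subrr g) rdotBl subrr.
have ng : 0 < hnorm g by rewrite lt0r hnorm_eq0 g0 hnorm_ge0.
have := rdot_ge0 ((hnorm g)%:C%C *: f - (hnorm f)%:C%C *: g).
rewrite !(rdotBl, rdotBr) !(rdotZl, rdotZr) -!hnorm_sqr [rdot g f]rdotC.
move: (hnorm_ge0 f) ng; rewrite le0r => /orP[|].
  rewrite hnorm_eq0 => /eqP-> _ _.
  by rewrite hnorm0 mul0r -(subrr g) rdotBl subrr.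
move: (hnorm f) (hnorm g) (rdot f g) => a b r a0 b0 H0.
have: 0 <= (a * b) * (a * b - r) by nra.
by rewrite pmulr_rge0 ?mulr_gt0// subr_ge0.
Qed.

Lemma rdot_cauchy_schwarz_abs f g : `|rdot f g| <= hnorm f * hnorm g.
Proof.
rewrite ler_norml rdot_cauchy_schwarz andbT lerNl -rdotNl -(hnormN f).
exact: rdot_cauchy_schwarz.
Qed.

(** Completeness in terms of real radii: a positive element of [R[i]] is a
    positive real number. *)
Lemma hnorm_complete (u : nat -> H) :
  (forall e : R, 0 < e -> exists N, forall n m,
    (N <= n)%N -> (N <= m)%N -> hnorm (u n - u m) < e) ->
  exists l, forall e : R, 0 < e -> exists N, forall n,
    (N <= n)%N -> hnorm (l - u n) < e.
Proof.
move=> cu.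
have posE (e : R[i]) : 0 < e -> 0 < complex.Re e /\ e = (complex.Re e)%:C%C.
  by move=> e0; rewrite RRe_real ?gtr0_real//; split=> //; move: e0; rewrite ltcE => /andP[].
have /cauchy_cvgP : cauchy (u @ \oo).
  apply: cauchy_exP => e /posE[e0 eE].
  have [N NP] := cu _ e0; exists (u N).
  exists N => // n Nn; rewrite -ball_normE /ball_ /= normr_hnorm eE ltcR.
  exact: NP.
move=> /(@cvgrPdist_lt _ H) ul; exists (lim (u @ \oo)) => e e0.
have e0' : 0 < e%:C%C by rewrite ltcR.
have [N _ NP] := ul _ e0'.
by exists N => n /NP /=; rewrite normr_hnorm ltcR.
Qed.

End real_inner_product.

Section bounded_operators.
Context (R : realType) (H K : hilbertType R).

Lemma boundedOp_bound (T : boundedOp H K) :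
  exists2 C : R, 0 < C & forall f, hnorm (T f) <= C * hnorm f.
Proof.
have /linear_bounded_continuous/linear_boundedP : continuous T by exact: cts_fun.
move=> [M [Mreal MP]].
have M1 : M < `|M| + 1 by rewrite ltr_pwDr// real_ler_norm.
exists (complex.Re (`|M| + 1)).
  have : 0 < `|M| + 1 :> R[i] by rewrite ltr_wpDl.
  by rewrite ltcE => /andP[].
move=> f; rewrite -lecR rmorphM /= -!normr_hnorm.
suff -> : (complex.Re (`|M| + 1))%:C%C = `|M| + 1 by exact: MP.
by apply: RRe_real; rewrite realD// normr_real.
Qed.

Lemma boundedOp_of (F : H -> K) (C : R) :
  (forall c f g, F (c *: f + g) = c *: F f + F g) ->
  (forall f, hnorm (F f) <= C * hnorm f) ->
  exists T : boundedOp H K, forall f, T f = F f.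
Proof.
move=> Flin FC.
pose L0 := GRing.isLinear.Build _ _ _ _ F Flin.
pose L : {linear H -> K} := HB.pack F L0.
have Lc : continuous L.
  apply/linear_bounded_continuous/linear_boundedP.
  exists C%:C%C; split; first by apply/Creal_ImP; rewrite -complexIm.
  move=> r Cr f; rewrite (le_trans _ (ler_wpM2r (normr_ge0 f) (ltW Cr)))//.
  by rewrite !normr_hnorm -rmorphM lecR; exact: FC.
pose C0 := @isContinuous.Build H K L Lc.
pose T : boundedOp H K := HB.pack F L0 C0.
by exists T.
Qed.
End bounded_operators.

(** * Representation of functionals, and inversion of coercive operators *)

Section riesz_lax_milgram.
Context (R : realType) (H : hilbertType R).

(** The minimiser of [J f = |T f|^2 - 2 phi f] is the required [u], because the
    derivative of [J] at [u] in the direction [v] is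
    [2 (<T u, T v> - phi v)]. The functional [J] is bounded below since [T] is
    bounded below, and a minimising sequence is Cauchy by the parallelogram law.
    With [T] the identity this is the Riesz representation theorem; with [T]
    coercive it is the main step of the Lax-Milgram theorem. *)
Lemma gram_form_representation (T : boundedOp H H) (c C : R) (phi : H -> R) :
  0 < c -> (forall f, c * hnorm f <= hnorm (T f)) ->
  (forall f g, phi (f + g) = phi f + phi g) ->
  (forall (t : R) f, phi (t%:C%C *: f) = t * phi f) ->
  (forall f, phi f <= C * hnorm f) ->
  exists u, forall v, rdot (T u) (T v) = phi v.
Proof.
move=> c0 Tc phiD phiZ phiC.
pose J f : R := hnorm (T f) ^+ 2 - 2 * phi f.
have TD f g : T (f + g) = T f + T g by exact: linearD.
have TZ t f : T (t *: f) = t *: T f by exact: linearZ.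
have JE (t : R) f g : J (f + t%:C%C *: g) =
    J f + 2 * t * (rdot (T f) (T g) - phi g) + t ^+ 2 * hnorm (T g) ^+ 2.
  rewrite /J phiD phiZ TD TZ !hnorm_sqr !(rdotDl, rdotDr, rdotZl, rdotZr).
  by rewrite [rdot (T g) (T f)]rdotC; ring.
have Jlb f : - (C ^+ 2 / c ^+ 2) <= J f.
  have n0 := hnorm_ge0 f.
  have : (c * hnorm f) ^+ 2 <= hnorm (T f) ^+ 2.
    by rewrite ler_sqr ?nnegrE ?hnorm_ge0 ?mulr_ge0// ltW.
  have := phiC f; rewrite /J => h1 h2.
  have h3 : 0 <= (c * hnorm f - C / c) ^+ 2 by exact: sqr_ge0.
  suff h4 : (c * hnorm f - C / c) ^+ 2 =
      (c * hnorm f) ^+ 2 - 2 * (C * hnorm f) + C ^+ 2 / c ^+ 2.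
    by rewrite h4 in h3; lra.
  by field; rewrite gt_eqF.
pose I := inf (range J).
have hasJ : has_inf (range J).
  split; first by exists (J 0); exists 0.
  by exists (- (C ^+ 2 / c ^+ 2)) => _ [f _ <-].
have Jge f : I <= J f by apply: ge_inf; [exact: hasJ.2|exists f].
have /choice[u uP] : forall n : nat, exists f, J f < I + n.+1%:R^-1.
  move=> n; have n0 : 0 < n.+1%:R^-1 :> R by rewrite invr_gt0 ltr0n.
  by have [_ [f _ <-] Jf] := inf_adherent n0 hasJ; exists f.
have small (e : R) : 0 < e -> exists N, forall n, (N <= n)%N -> n.+1%:R^-1 < e.
  move=> e0; exists (Num.truncn e^-1) => n Nn.
  rewrite invf_plt ?posrE ?ltr0n//.
  rewrite (lt_le_trans (truncnS_gt _))// ler_nat ltnS//.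
(* the parallelogram law, from the values of [J] at [f], [g] and their midpoint *)
have par f g : c ^+ 2 * hnorm (f - g) ^+ 2 <= 2 * (J f + J g - 2 * I).
  have := Jge (f + (1 / 2)%:C%C *: (g - f)).
  have := JE 1 f (g - f).
  rewrite scale1r addrC subrK => J1.
  rewrite JE => J2.
  have TT : c ^+ 2 * hnorm (f - g) ^+ 2 <= hnorm (T (g - f)) ^+ 2.
    rewrite -(hnormN (f - g)) opprB -exprMn ler_sqr ?nnegrE ?hnorm_ge0//.
    by rewrite mulr_ge0 ?hnorm_ge0 ?ltW.
  by lra.
have /hnorm_complete [l lP] : forall e : R, 0 < e ->
    exists N, forall n m, (N <= n)%N -> (N <= m)%N -> hnorm (u n - u m) < e.
  move=> e e0.
  have [N NP] := small (c ^+ 2 * e ^+ 2 / 4) ltac:(by rewrite divr_gt0 ?mulr_gt0 ?exprn_gt0).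
  exists N => n m Nn Nm.
  rewrite -(ltr_pXn2r (n := 2)) ?nnegrE ?hnorm_ge0 ?(ltW e0)//.
  rewrite -(ltr_pM2l (exprn_gt0 2 c0)).
  have := par (u n) (u m); have := uP n; have := uP m; have := NP n Nn; have := NP m Nm.
  move: (J (u n)) (J (u m)) n.+1%:R^-1 m.+1%:R^-1 (hnorm (u n - u m)) => a b p q r.
  by lra.
exists l => v; apply/eqP; rewrite -subr_eq0; set D := _ - _.
have [CT CT0 TP] := boundedOp_bound T.
(* minimality of [J l], obtained in the limit from [I <= J (u n + t v)] *)
have nonneg (t : R) : 0 <= 2 * t * D + t ^+ 2 * hnorm (T v) ^+ 2.
  rewrite leNgt; apply/negP; set q := (X in X < 0) => q0.
  pose b := 2 * (`|t| * CT * hnorm (T v)) + 1.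
  have b0 : 0 < b by rewrite ltr_wpDl// !mulr_ge0 ?hnorm_ge0 ?(ltW CT0).
  have [N1 N1P] := small (- q / 2) ltac:(lra).
  have [N2 N2P] := lP (- q / 2 / b) ltac:(by rewrite divr_gt0//; lra).
  pose n := maxn N1 N2.
  have := N1P n (leq_maxl _ _); have := N2P n (leq_maxr _ _).
  rewrite ltr_pdivlMr// => h1 h2.
  have h3 := uP n; have := Jge (u n + t%:C%C *: v); rewrite JE => h4.
  have h5 : rdot (T (u n)) (T v) = rdot (T l) (T v) - rdot (T (l - u n)) (T v).
    by rewrite -rdotBl -linearB /= opprB addrC subrK.
  have h6 : `|t * rdot (T (l - u n)) (T v)| <= hnorm (l - u n) * (`|t| * CT * hnorm (T v)).
    rewrite normrM (_ : _ * (_ * _) = `|t| * (CT * hnorm (l - u n) * hnorm (T v))); last by ring.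
    rewrite ler_wpM2l// (le_trans (rdot_cauchy_schwarz_abs _ _))//.
    by rewrite ler_wpM2r ?hnorm_ge0.
  move: h6 => /ler_normlP[h6 h7].
  have := hnorm_ge0 (l - u n).
  have qE : q = 2 * t * (rdot (T l) (T v) - phi v) + t ^+ 2 * hnorm (T v) ^+ 2 by [].
  move: h1 h4 h6 h7; rewrite /b h5.
  move: qE q0 h2 h3.
  move: (hnorm (l - u n)) (rdot (T l) _) (rdot (T (_ - _)) _)
    (`|t| * CT * hnorm (T v)) (hnorm (T v)) => x r s y z.
  move: (J _) n.+1%:R^-1 => j p.
  by lra.
(* a negative value of the quadratic in [t] when [D] is nonzero; the [+ 1]
   avoids a case distinction on [T v = 0] *)
have := nonneg (- D / (hnorm (T v) ^+ 2 + 1)).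
set a := hnorm (T v) ^+ 2.
have a0 : 0 <= a by exact: sqr_ge0.
rewrite (_ : _ + _ = - (D ^+ 2 * ((a + 2) / (a + 1) ^+ 2))); last first.
  by field; rewrite gt_eqF// ltr_wpDl.
rewrite oppr_ge0 pmulr_lle0; last by rewrite divr_gt0 ?exprn_gt0 ?ltr_wpDl.
by move=> D0; rewrite -sqrf_eq0 eq_le D0 sqr_ge0.
Qed.

Lemma hnorm_le_of_rdot (x : H) (k : R) :
  0 <= k -> (forall g, rdot x g <= k * hnorm g) -> hnorm x <= k.
Proof.
move=> k0 /(_ x); rewrite -hnorm_sqr expr2.
have := hnorm_ge0 x; rewrite le0r => /orP[/eqP->//|x0].
by rewrite ler_pM2r.
Qed.

(** The Riesz representative of [b f] depends complex-linearly on [f]: real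
    bilinearity together with the compatibility of [b] with complex scalars
    says so after pairing with an arbitrary vector. *)
Lemma bounded_form_operator (b : H -> H -> R) (C : R) : 0 <= C ->
  (forall f f' g, b (f + f') g = b f g + b f' g) ->
  (forall f g g', b f (g + g') = b f g + b f g') ->
  (forall (t : R) f g, b f (t%:C%C *: g) = t * b f g) ->
  (forall (c : R[i]) f g, b (c *: f) g = b f (c^*%C *: g)) ->
  (forall f g, b f g <= C * hnorm f * hnorm g) ->
  exists M : boundedOp H H, forall f g, rdot (M f) g = b f g.
Proof.
move=> C0 bDl bDr bZr bZ bC.
have [I IE] : exists I : boundedOp H H, forall f, I f = f.
  by apply: (@boundedOp_of _ _ _ id 1) => // f; rewrite mul1r.
have /choice[F FE] : forall f, exists u, forall g, rdot u g = b f g.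
  move=> f; have [||||u uE] := @gram_form_representation I 1 (C * hnorm f) (b f) ltr01.
  - by move=> g; rewrite IE mul1r.
  - by move=> g g'; exact: bDr.
  - by move=> t g; exact: bZr.
  - by move=> g; exact: bC.
  - by exists u => g; rewrite -uE !IE.
have [M ME] : exists M : boundedOp H H, forall f, M f = F f.
  apply: (@boundedOp_of _ _ _ F C) => [c f g|f].
    by apply: rdot_inj => h; rewrite rdotDl rdotZ !FE bDl bZ.
  apply: hnorm_le_of_rdot; first by rewrite mulr_ge0 ?hnorm_ge0.
  by move=> g; rewrite FE.
by exists M => f g; rewrite ME.
Qed.

(** Representing [v |-> <h, T v>] yields [u] with [T u - h] orthogonal to the range
    of [T]; coercivity applied to [T u - h] itself then gives [T u = h]. *)
Lemma lax_milgram (T : boundedOp H H) (c : R) : 0 < c ->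
  (forall f, c * hnorm f ^+ 2 <= rdot (T f) f) ->
  exists T', inverse_op T T' /\ forall f, hnorm (T' f) <= c^-1 * hnorm f.
Proof.
move=> c0 Tc.
have Tbelow f : c * hnorm f <= hnorm (T f).
  have := hnorm_ge0 f; rewrite le0r => /orP[/eqP->|f0].
    by rewrite mulr0 hnorm_ge0.
  rewrite -(ler_pM2r f0) -mulrA -expr2 (le_trans (Tc f))//.
  exact: rdot_cauchy_schwarz.
have Tinj f : T f = 0 -> f = 0.
  move=> Tf0; apply/eqP; rewrite -hnorm_eq0 eq_le hnorm_ge0 andbT.
  by rewrite -(ler_pM2l c0) mulr0 (le_trans (Tbelow f))// Tf0 hnorm0.
have [CT CT0 TC] := boundedOp_bound T.
have /choice[F FE] : forall h, exists u, T u = h.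
  move=> h.
  have [|||u uE] := @gram_form_representation T c (hnorm h * CT)
    (fun v => rdot h (T v)) c0 Tbelow.
  - by move=> f g; rewrite linearD rdotDr.
  - by move=> t f; rewrite linearZ /= rdotZr.
  - move=> f; rewrite (le_trans (rdot_cauchy_schwarz _ _))// -mulrA.
    by rewrite ler_wpM2l ?hnorm_ge0.
  exists u; apply/eqP; rewrite -subr_eq0 -hnorm_eq0 -sqrf_eq0.
  rewrite eq_le sqr_ge0 andbT -(ler_pM2l c0) mulr0 (le_trans (Tc _))//.
  by rewrite rdotC rdotBl uE subrr.
have TK f : F (T f) = f.
  by apply/eqP; rewrite -subr_eq0; apply/eqP/Tinj; rewrite linearB /= FE subrr.
have FC f : hnorm (F f) <= c^-1 * hnorm f.
  by rewrite ler_pdivlMl// (le_trans (Tbelow _))// FE.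
have [T' T'E] : exists T' : boundedOp H H, forall f, T' f = F f.
  apply: (@boundedOp_of _ _ _ F c^-1) => // k f g.
  by rewrite -[RHS]TK linearD linearZ /= !FE.
by exists T'; split=> [|f]; [split=> f|]; rewrite T'E.
Qed.

End riesz_lax_milgram.

(** * The Neumann series *)

Section neumann.
Context (R : realType) (H : hilbertType R).
Implicit Types S M : boundedOp H H.

(** With [E = S^-1 (S - M)] one has [1 - E = S^-1 M], that is,
    [S^-1 = (1 - E) M^-1]; hence the partial sum of [E^k S^-1] telescopes to
    [M^-1 - E^(n+1) M^-1]. *)
Lemma neumann_remainder S M (S' M' : boundedOp H H) n f : inverse_op S S' -> inverse_op M M' ->
  M' f - neumann_sum S S' M n f = iter n.+1 (fun h => S' (S h - M h)) (M' f).
Proof.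
move=> [SK _] [_ M'K]; set E := fun h => _.
have EB g h : E (g - h) = E g - E h.
  have B (L : boundedOp H H) x y : L (x - y) = L x - L y by exact: linearB.
  by rewrite /E !B !opprD !opprK addrACA.
have first_term : S' f = M' f - E (M' f).
  by rewrite /E linearB /= SK M'K opprB addrC subrK.
have iterB k g h : iter k E (g - h) = iter k E g - iter k E h.
  by elim: k => //= k ->.
have -> : neumann_sum S S' M n f = \sum_(k < n.+1) (iter k E (M' f) - iter k.+1 E (M' f)).
  by apply: eq_bigr => k _; rewrite -/E first_term iterB -iterSr.
have -> : \sum_(k < n.+1) (iter k E (M' f) - iter k.+1 E (M' f)) = M' f - iter n.+1 E (M' f).
  elim: n => [|n IH]; first by rewrite big_ord1.
  by rewrite big_ord_recr IH /= addrA subrK.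
by rewrite opprB addrC subrK.
Qed.

Lemma hnorm_iter_le (F : H -> H) (q : R) n f : 0 <= q ->
  (forall h, hnorm (F h) <= q * hnorm h) -> hnorm (iter n F f) <= q ^+ n * hnorm f.
Proof.
move=> q0 Fq; elim: n => [|n IH] /=; first by rewrite expr0 mul1r.
by rewrite (le_trans (Fq _))// exprS -mulrA ler_wpM2l.
Qed.

Lemma opnorm_le (F : H -> H) (k : R) : 0 <= k ->
  (forall f, hnorm (F f) <= k * hnorm f) -> (opnorm F <= k%:E)%E.
Proof.
move=> k0 Fk; apply: ge_ereal_sup => _ [f /= f1 <-].
by rewrite lee_fin (le_trans (Fk f))// ler_piMr.
Qed.

Lemma opnorm_ge0 (F : H -> H) : (0 <= opnorm F)%E.
Proof.
apply: (@le_trans _ _ (hnorm (F 0))%:E); first by rewrite lee_fin hnorm_ge0.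
by apply: ereal_sup_ubound; exists 0 => //=; rewrite hnorm0 ler01.
Qed.

End neumann.

(** * Strong measurability and integral estimates *)

Section strong_measurability.
Context d (T : measurableType d) (R : realType).

Lemma sqnorm_sum_ge (K : T -> hilbertType R) (x : forall w, K w) w :
  ((hnorm (x w) ^+ 2)%:E <= sqnorm_sum x)%E.
Proof.
rewrite /sqnorm_sum (esumID [set w]); last by move=> *; rewrite lee_fin sqr_ge0.
rewrite setTI esum_set1 ?lee_fin ?sqr_ge0// leeDl// esum_ge0// => i _.
by rewrite lee_fin sqr_ge0.
Qed.

(** Coordinates are continuous on the direct sum, so for any set [E] of indices
    the vectors with a nonzero coordinate in [E] form an open set. As the image of
    [w] has its only possibly nonzero coordinate at [w], the preimage of this open
    set is the part of [E] on which [F] does not vanish. *)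
Lemma strongly_measurable_subsupport (K : T -> hilbertType R) (F : forall w, K w) :
  strongly_measurable F ->
  forall E, E `<=` [set w | F w != 0] -> measurable E.
Proof.
move=> mF E EF.
pose U : set (direct_sum K) := [set x | exists2 w, E w & x w != 0].
have <- : [set w | U (ds_inj (F w))] = E.
  apply/seteqP; split=> [w /= [v Ev]|w Ew]; last first.
    by exists w => //=; rewrite /single dfwithin; exact: EF.
  rewrite /= /single; have [->//|wv] := eqVneq w v.
  by rewrite dfwithout ?eqxx.
apply: mF; apply: sub_sigma_algebra => x [w Ew xw0].
have nx0 : 0 < hnorm (x w) by rewrite lt0r hnorm_eq0 xw0 hnorm_ge0.
exists (hnorm (x w)) => // y; rewrite /dsball /= => xy.
exists w => //; apply/eqP => yw0.
have := le_lt_trans (sqnorm_sum_ge (fun i => x i - y i) w) xy.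
by rewrite yw0 subr0 ltxx.
Qed.

(** The preimage of a set either is contained in [V] or has its complement in
    [V], according to whether the set contains [0]. *)
Lemma measurable_fun_subsupport (V : set T) (h : T -> R) :
  (forall E, E `<=` V -> measurable E) -> (forall w, ~ V w -> h w = 0) ->
  measurable_fun setT h.
Proof.
move=> mV h0 _ Y mY; rewrite setTI.
have [Y0|Y0] := pselect (Y 0); last first.
  by apply: mV => w /= Yw; apply: contrapT => /h0 hw; rewrite hw in Yw.
rewrite -(setCK (h @^-1` Y)); apply: measurableC; apply: mV => w /= Yw.
by apply: contrapT => /h0 hw; apply: Yw; rewrite hw.
Qed.

End strong_measurability.

Section integral_cauchy_schwarz.
Context d (T : measurableType d) (R : realType) (mu : {measure set T -> \bar R}).

Lemma Lnorm2_le (p : T -> R) (a : R) :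
  (\int[mu]_w (p w ^+ 2)%:E <= a%:E)%E ->
  ('N[mu]_2%:E[EFin \o p] <= (Num.sqrt a)%:E)%E.
Proof.
move=> pa; have a0 : 0 <= a.
  by rewrite -lee_fin (le_trans _ pa)// integral_ge0// => w _; rewrite lee_fin sqr_ge0.
rewrite unlock /= -powR12_sqrt// -poweR_EFin.
have -> : (\int[mu]_x (`|(EFin \o p) x| `^ 2) = \int[mu]_w (p w ^+ 2)%:E)%E.
  by apply: eq_integral => w _ /=; rewrite powR_mulrn// real_normK// num_real.
apply: gt0_ler_poweR => //.
by rewrite in_itv/= leey andbT integral_ge0// => w _; rewrite lee_fin sqr_ge0.
by rewrite in_itv/= leey andbT lee_fin.
Qed.

(** Hoelder's inequality with exponents [2, 2], in the form that yields
    integrability and the bound at the same time. *)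
Lemma integral_cauchy_schwarz (h p q : T -> R) (c a b : R) :
  measurable_fun setT h -> measurable_fun setT p -> measurable_fun setT q ->
  0 <= c -> {ae mu, forall w, `|h w| <= c * `|p w * q w|} ->
  (\int[mu]_w (p w ^+ 2)%:E <= a%:E)%E ->
  (\int[mu]_w (q w ^+ 2)%:E <= b%:E)%E ->
  mu.-integrable setT (EFin \o h) /\
  `|(\int[mu]_w h w)%R| <= c * (Num.sqrt a * Num.sqrt b).
Proof.
move=> mh mp mq c0 hpq pa qb.
have bound : (\int[mu]_w `|(h w)%:E| <= (c * (Num.sqrt a * Num.sqrt b))%:E)%E.
  apply: (@le_trans _ _ (\int[mu]_w (c * `|p w * q w|)%:E)%E).
    apply: ae_ge0_le_integral => //.
    - by apply/measurable_EFinP; apply: measurableT_comp.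
    - by move=> w _; rewrite lee_fin mulr_ge0.
    - apply/measurable_EFinP; apply: measurable_funM => //.
      by apply: measurableT_comp => //; exact: measurable_funM.
    - by apply: filterS hpq => w hw _; rewrite /= lee_fin.
  under eq_integral do rewrite EFinM.
  rewrite ge0_integralZl_EFin//; last first.
    by apply/measurable_EFinP; apply: measurableT_comp => //; exact: measurable_funM.
  rewrite EFinM lee_pmul//; first by apply: integral_ge0.
  have := hoelder mu mp mq (p := 2) (q := 2) ltac:(by []) ltac:(by []) ltac:(by field).
  rewrite Lnorm1 => /le_trans; apply.
  by rewrite EFinM lee_pmul ?Lnorm_ge0 ?Lnorm2_le.
have ih : mu.-integrable setT (EFin \o h).
  apply/integrableP; split; first exact/measurable_EFinP.
  exact: le_lt_trans bound (ltry _).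
split=> //; rewrite -lee_fin (le_trans _ bound)//.
by rewrite EFin_normr_Rintegral// le_abse_integral//; exact: measurable_int ih.
Qed.

End integral_cauchy_schwarz.

(** * Existence of multipliers *)

Section gframes.
Context d (T : measurableType d) (R : realType) (mu : {measure set T -> \bar R}).
Context (H : hilbertType R) (K : T -> hilbertType R).
Implicit Types (L Th : forall w, boundedOp H (K w)) (p m : T -> R).

Definition bessel_bound (X : forall w, K w) (a : R) :=
  measurable_fun setT (fun w => hnorm (X w)) /\
  (\int[mu]_w (hnorm (X w) ^+ 2)%:E <= a%:E)%E.

Lemma measurable_hnorm (X : forall w, K w) :
  strongly_measurable X -> measurable_fun setT (fun w => hnorm (X w)).
Proof.
move=> mX; apply: (measurable_fun_subsupport (strongly_measurable_subsupport mX)).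
by move=> w /negP; rewrite negbK => /eqP->; rewrite hnorm0.
Qed.

Lemma measurable_hnormB (X Y : forall w, K w) :
  strongly_measurable X -> strongly_measurable Y ->
  measurable_fun setT (fun w => hnorm (X w - Y w)).
Proof.
move=> mX mY.
apply: (@measurable_fun_subsupport _ _ _ ([set w | X w != 0] `|` [set w | Y w != 0])).
  move=> E EXY; rewrite -(setIidl EXY) setIUr; apply: measurableU.
    by apply: (strongly_measurable_subsupport mX); exact: subIsetr.
  by apply: (strongly_measurable_subsupport mY); exact: subIsetr.
move=> w /= /not_orP[/negP + /negP]; rewrite !negbK => /eqP-> /eqP->.
by rewrite subr0 hnorm0.
Qed.

(** The sum of two strongly measurable families may a priori fail to be
    measurable in a nonseparable direct sum, so polarisation is not at hand;
    here everything is supported where [Y] does not vanish, and there all sets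
    are measurable. *)
Lemma measurable_weighted_rdot (a : T -> R) (X Y : forall w, K w) :
  strongly_measurable Y -> measurable_fun setT (fun w => a w * rdot (X w) (Y w)).
Proof.
move=> mY; apply: (measurable_fun_subsupport (strongly_measurable_subsupport mY)).
move=> w /negP; rewrite negbK => /eqP->.
by rewrite rdotC -(subrr 0) rdotBl subrr mulr0.
Qed.

Lemma weighted_rdot_integral p c (X Y : forall w, K w) a b :
  strongly_measurable Y -> 0 <= c -> {ae mu, forall w, `|p w| <= c} ->
  bessel_bound X a -> bessel_bound Y b ->
  mu.-integrable setT (EFin \o (fun w => p w * rdot (X w) (Y w))) /\
  `|(\int[mu]_w (p w * rdot (X w) (Y w)))%R| <= c * (Num.sqrt a * Num.sqrt b).
Proof.
move=> mY c0 pc [mX Xa] [mY' Yb].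
apply: (@integral_cauchy_schwarz _ _ _ _ _
  (fun w => hnorm (X w)) (fun w => hnorm (Y w))) => //.
  exact: measurable_weighted_rdot.
apply: filterS pc => w pwc; rewrite normrM ler_pM//.
by rewrite (le_trans (rdot_cauchy_schwarz_abs _ _))// ler_norm.
Qed.

Lemma Re_weighted_inner (t : R) (E : hilbertType R) (x y : E) :
  complex.Re (t%:C%C * inner x y) = t * rdot x y.
Proof. by rewrite /rdot; case: (inner x y) => a b /=; rewrite mul0r subr0. Qed.

Lemma Im_weighted_inner (t : R) (E : hilbertType R) (x y : E) :
  complex.Im (t%:C%C * inner x y) = t * rdot x ('i%C *: y).
Proof. by rewrite -Im_inner; case: (inner x y) => a b /=; rewrite mul0r addr0. Qed.

Lemma multiplier_rdot p L Th (M : boundedOp H H) : is_multiplier mu p L Th M ->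
  forall f g, mu.-integrable setT (EFin \o (fun w => p w * rdot (Th w f) (L w g))) /\
    rdot (M f) g = (\int[mu]_w (p w * rdot (Th w f) (L w g)))%R.
Proof.
move=> MM f g; have [[iRe _] Mfg] := MM f g.
have <- : (fun w => complex.Re ((p w)%:C%C * inner (Th w f) (L w g))) =
          (fun w => p w * rdot (Th w f) (L w g)).
  by apply/funext => w; rewrite Re_weighted_inner.
by split=> //; rewrite /rdot Mfg.
Qed.

(** The integral of [p <Th f, L g>] is a bounded sesquilinear form by
    Cauchy-Schwarz, hence represented by an operator. The representation only
    prescribes real parts; replacing [g] by [i g] recovers the imaginary
    ones. *)
Lemma multiplier_exists p c L Th (b B : R) :
  (forall f, strongly_measurable (fun w => L w f)) ->
  (forall f, bessel_bound (fun w => L w f) (B * hnorm f ^+ 2)) ->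
  (forall f, bessel_bound (fun w => Th w f) (b * hnorm f ^+ 2)) ->
  0 <= b -> 0 <= B -> 0 <= c -> {ae mu, forall w, `|p w| <= c} ->
  exists M, is_multiplier mu p L Th M.
Proof.
move=> mL LB Thb b0 B0 c0 pc.
have key f g := weighted_rdot_integral (mL g) c0 pc (Thb f) (LB g).
pose form f g := (\int[mu]_w (p w * rdot (Th w f) (L w g)))%R.
have [||||||M ME] := @bounded_form_operator _ H form (c * (Num.sqrt b * Num.sqrt B)).
- by rewrite !mulr_ge0 ?sqrtr_ge0.
- move=> f f' g; rewrite /form -RintegralD//; [|exact: (key _ _).1..].
  by apply: eq_Rintegral => w _; rewrite linearD rdotDl mulrDr.
- move=> f g g'; rewrite /form -RintegralD//; [|exact: (key _ _).1..].
  by apply: eq_Rintegral => w _; rewrite linearD rdotDr mulrDr.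
- move=> t f g; rewrite /form -RintegralZl//; [|exact: (key _ _).1].
  by apply: eq_Rintegral => w _; rewrite linearZ /= rdotZr mulrCA.
- move=> k f g; apply: eq_Rintegral => w _.
  by rewrite [in LHS]linearZ [in RHS]linearZ /= rdotZ.
- move=> f g; rewrite (le_trans (ler_norm _))// (le_trans (key f g).2)//.
  rewrite (sqrtrM _ b0) (sqrtrM _ B0) !sqrtr_sqr !ger0_norm ?hnorm_ge0//.
  by rewrite le_eqVlt; apply/orP; left; apply/eqP; ring.
exists M => f g F.
have ReF : (fun w => complex.Re (F w)) = (fun w => p w * rdot (Th w f) (L w g)).
  by apply/funext => w; rewrite Re_weighted_inner.
have ImF : (fun w => complex.Im (F w)) = (fun w => p w * rdot (Th w f) (L w ('i%C *: g))).
  by apply/funext => w; rewrite Im_weighted_inner linearZ.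
split; first by split; rewrite ?ReF ?ImF; exact: (key _ _).1.
by apply: inner_ext; rewrite /= ?ReF ?ImF ME.
Qed.

Lemma sqrt_weighted_inner m L w f g :
  inner (sqrt_weighted m L w f) (sqrt_weighted m L w g) =
  ((Num.sqrt (m w) ^+ 2)%:C%C * inner (L w f) (L w g)).
Proof.
rewrite /= linearZl_LR linearZr_LR /= mulrA; congr (_ * _).
by rewrite [X in _ * X](_ : _ = (Num.sqrt (m w))%:C%C) ?rmorphXn ?expr2//= /Num.conj /= oppr0.
Qed.

(** The weight is [(sqrt m)^2] rather than [m]: the two differ where [m] is
    negative, which happens at most on a negligible set for the weights of
    interest. *)
Lemma frame_operator_multiplier m L (S : boundedOp H H) :
  (forall f g, let F w := inner (sqrt_weighted m L w f) (sqrt_weighted m L w g) in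
      cintegrable mu F /\ inner (S f) g = cintegral mu F) <->
  is_multiplier mu (fun w => Num.sqrt (m w) ^+ 2) L L S.
Proof.
split=> SS f g F; have := SS f g => /=.
  by under eq_fun do rewrite sqrt_weighted_inner.
by rewrite /F; under [in X in _ -> X]eq_fun do rewrite sqrt_weighted_inner.
Qed.

End gframes.

(** * Bounds for the frame operator and the multiplier *)

Section estimates.
Context d (T : measurableType d) (R : realType) (mu : {measure set T -> \bar R}).

Lemma Linfty_norm_ge0 (m : T -> R) : 0 <= Linfty_norm mu m.
Proof. by rewrite fine_ge0// Lnorm_ge0. Qed.

(** The essential supremum is replaced by [0] in the norm when the whole space
    has measure zero, a case where every property holds almost everywhere. *)
Lemma Linfty_norm_ae (m : T -> R) : m \in Lfun mu +oo%E ->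
  {ae mu, forall w, `|m w| <= Linfty_norm mu m}.
Proof.
move=> /andP[_]; rewrite inE /= /finite_norm => mfin.
have mfin' : ('N[mu]_+oo[EFin \o m])%E \is a fin_num.
  by rewrite ge0_fin_numE// Lnorm_ge0.
move: mfin'; rewrite /Linfty_norm unlock.
case: ifPn => [_ fin|]; last first.
  rewrite -leNgt => mu0 _; exists setT; split=> //.
  by apply/eqP; rewrite eq_le mu0 measure_ge0.
apply: filterS (ess_sup_ge mu (abse \o (EFin \o m))) => w /=.
by rewrite -[X in (_ <= X)%E -> _](fineK fin) lee_fin.
Qed.

Context (H : hilbertType R) (K : T -> hilbertType R).
Context (L Th : forall w, boundedOp H (K w)) (A B nu delta c : R) (m : T -> R).
Hypotheses (frameL : continuous_gframe mu A B L)
  (mTh : forall f, strongly_measurable (fun w => Th w f)) (nu0 : 0 <= nu)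
  (LTh : forall f, (\int[mu]_w (hnorm (L w f - Th w f) ^+ 2)%:E
              <= (nu * hnorm f ^+ 2)%:E)%E)
  (c0 : 0 <= c) (mc : {ae mu, forall w, `|m w| <= c})
  (delta0 : 0 < delta) (mdelta : {ae mu, forall w, delta <= m w}).

Let mL f : strongly_measurable (fun w => L w f).
Proof. by case: frameL. Qed.

Let A0 : 0 < A. Proof. by case: frameL. Qed.

Let B0 : 0 < B. Proof. by case: frameL => _ a0 ab _; exact: lt_le_trans ab. Qed.

Let n w := Num.sqrt (m w) ^+ 2.

Let nm : {ae mu, forall w, n w = m w}.
Proof.
by apply: filterS mdelta => w mw; rewrite /n sqr_sqrtr// (le_trans (ltW delta0)).
Qed.

Let nc : {ae mu, forall w, `|n w| <= c}.
Proof. by apply: filterS2 nm mc => w nw mw; rewrite nw. Qed.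

Lemma bessel_L f : bessel_bound mu (fun w => L w f) (B * hnorm f ^+ 2).
Proof. by split; [exact: measurable_hnorm|case: frameL => _ _ _ /(_ f)/andP[]]. Qed.

Lemma bessel_sub f : bessel_bound mu (fun w => L w f - Th w f) (nu * hnorm f ^+ 2).
Proof. by split; [exact: measurable_hnormB|exact: LTh]. Qed.

(** From [|Th f|^2 <= 2 |L f|^2 + 2 |L f - Th f|^2]. *)
Lemma bessel_Th f : bessel_bound mu (fun w => Th w f) ((2 * B + 2 * nu) * hnorm f ^+ 2).
Proof.
split; first exact: measurable_hnorm.
have [ml Lb] := bessel_L f; have [ms sb] := bessel_sub f.
have msq (g : T -> R) : measurable_fun setT g -> measurable_fun setT (fun w => (g w ^+ 2)%:E).
  by move=> mg; apply/measurable_EFinP; exact: measurable_funX.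
apply: (@le_trans _ _ (\int[mu]_w
   (2%:E * (hnorm (L w f) ^+ 2)%:E + 2%:E * (hnorm (L w f - Th w f) ^+ 2)%:E))%E).
  apply: ge0_le_integral => //.
  - by move=> w _; rewrite lee_fin sqr_ge0.
  - by apply: msq; exact: measurable_hnorm.
  - apply: emeasurable_funD; apply: measurable_funeM; exact: msq.
  - move=> w _; rewrite -!EFinM -EFinD lee_fin.
    have : hnorm (Th w f) <= hnorm (L w f) + hnorm (L w f - Th w f).
      rewrite -(hnormN (L w f - Th w f)) opprB.
      by rewrite (le_trans _ (hnormD _ _))// addrC subrK.
    have := hnorm_ge0 (Th w f); have := hnorm_ge0 (L w f).
    have := hnorm_ge0 (L w f - Th w f).
    move: (hnorm (Th w f)) (hnorm (L w f)) (hnorm (L w f - Th w f)) => x y z z0 y0 x0 xyz.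
    have : 0 <= (y - z) ^+ 2 by exact: sqr_ge0.
    nra.
have g0 (g : T -> R) (w : T) : setT w -> (0 <= (g w ^+ 2)%:E)%E by rewrite lee_fin sqr_ge0.
have g20 (g : T -> R) (w : T) : setT w -> (0 <= 2%:E * (g w ^+ 2)%:E)%E.
  by rewrite -EFinM lee_fin mulr_ge0// sqr_ge0.
have mg2 (g : T -> R) : measurable_fun setT g ->
    measurable_fun setT (fun w => 2%:E * (g w ^+ 2)%:E)%E.
  by move=> mg; apply: measurable_funeM; exact: msq.
rewrite (ge0_integralD _ _ (g20 _) (mg2 _ ml) (g20 _) (mg2 _ ms))//.
rewrite (ge0_integralZl_EFin _ _ (g0 _) (msq _ ml))//.
rewrite (ge0_integralZl_EFin _ _ (g0 _) (msq _ ms))//.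
have -> : ((2 * B + 2 * nu) * hnorm f ^+ 2)%:E =
    (2%:E * (B * hnorm f ^+ 2)%:E + 2%:E * (nu * hnorm f ^+ 2)%:E)%E.
  by rewrite -!EFinM -EFinD; congr EFin; ring.
by rewrite leeD// lee_pmul2l.
Qed.

Lemma gframe_multiplier_exists : exists M, is_multiplier mu m L Th M.
Proof.
apply: (multiplier_exists mL bessel_L bessel_Th _ _ c0 mc); last exact: ltW.
by rewrite addr_ge0 ?mulr_ge0// ltW.
Qed.

Variable S : boundedOp H H.
Hypothesis SP : is_multiplier mu n L L S.

Lemma hnorm_S_le f : hnorm (S f) <= c * B * hnorm f.
Proof.
apply: hnorm_le_of_rdot => [|g]; first by rewrite !mulr_ge0 ?hnorm_ge0// ltW.
rewrite (multiplier_rdot SP f g).2 (le_trans (ler_norm _))//.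
have [_ /le_trans] := weighted_rdot_integral (mL g) c0 nc (bessel_L f) (bessel_L g).
apply; rewrite !(sqrtrM _ (ltW B0)) !sqrtr_sqr !ger0_norm ?hnorm_ge0//.
rewrite [Num.sqrt B * _ * _](_ : _ = Num.sqrt B ^+ 2 * hnorm f * hnorm g); last by ring.
by rewrite (sqr_sqrtr (ltW B0)) !mulrA.
Qed.

Lemma rdot_S_ge f : delta * A * hnorm f ^+ 2 <= rdot (S f) f.
Proof.
have [iS ->] := multiplier_rdot SP f f.
have [mh _] := bessel_L f.
have mh2 : measurable_fun setT (fun w => (hnorm (L w f) ^+ 2)%:E).
  by apply/measurable_EFinP; exact: measurable_funX.
rewrite -lee_fin fineK; last exact: integrable_fin_num.
apply: (@le_trans _ _ (\int[mu]_w (delta%:E * (hnorm (L w f) ^+ 2)%:E))%E).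
  rewrite ge0_integralZl_EFin//; last exact: ltW.
    rewrite -mulrA EFinM lee_pmul2l ?lte_fin//.
    by case: frameL => _ _ _ /(_ f)/andP[].
  by move=> w _; rewrite lee_fin sqr_ge0.
apply: ae_ge0_le_integral => //.
- by move=> w _; rewrite -EFinM lee_fin mulr_ge0 ?sqr_ge0// ltW.
- exact: measurable_funeM.
- by move=> w _; rewrite lee_fin mulr_ge0 ?sqr_ge0 ?rdot_ge0.
- exact: measurable_int iS.
apply: filterS2 nm mdelta => w nw mw _.
by rewrite -EFinM lee_fin nw hnorm_sqr ler_wpM2r ?rdot_ge0.
Qed.

Variable M : boundedOp H H.
Hypothesis MP : is_multiplier mu m L Th M.

(** [S - M] is the multiplier with weight [m] of the pair formed by [L] and
    [L - Th], so it inherits the small Bessel bound [nu] of the difference. *)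
Lemma hnorm_subSM_le f : hnorm (S f - M f) <= c * Num.sqrt (nu * B) * hnorm f.
Proof.
apply: hnorm_le_of_rdot => [|g]; first by rewrite !mulr_ge0 ?hnorm_ge0.
have [iS Sfg] := multiplier_rdot SP f g; have [iM Mfg] := multiplier_rdot MP f g.
have [idiff] := weighted_rdot_integral (mL g) c0 mc (bessel_sub f) (bessel_L g).
rewrite rdotBl Sfg Mfg -RintegralB//.
have -> : (\int[mu]_w (n w * rdot (L w f) (L w g) - m w * rdot (Th w f) (L w g)))%R =
    (\int[mu]_w (m w * rdot (L w f - Th w f) (L w g)))%R.
  congr fine; apply: ae_eq_integral => //; [|exact: measurable_int idiff|].
    exact: (measurable_int _ (integrableB measurableT iS iM)).
  by apply: filterS nm => w nw _; rewrite nw rdotBl mulrBr.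
move=> /(le_trans (ler_norm _))/le_trans; apply.
rewrite (sqrtrM _ nu0) (sqrtrM _ (ltW B0)) (sqrtrM B nu0) !sqrtr_sqr !ger0_norm ?hnorm_ge0//.
by rewrite le_eqVlt; apply/orP; left; apply/eqP; ring.
Qed.

Lemma hnorm_M_le f : hnorm (M f) <= (c * B + c * Num.sqrt (nu * B)) * hnorm f.
Proof.
rewrite -(subKr (S f) (M f)) (le_trans (hnormD _ _))// hnormN mulrDl lerD//.
  exact: hnorm_S_le.
exact: hnorm_subSM_le.
Qed.

(** [M] is a perturbation of [S] smaller than the coercivity constant of [S],
    hence coercive as well. *)
Lemma rdot_M_ge f : (delta * A - c * Num.sqrt (nu * B)) * hnorm f ^+ 2 <= rdot (M f) f.
Proof.
rewrite -(subKr (S f) (M f)) rdotBl mulrBl lerB ?rdot_S_ge//.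
rewrite (le_trans (rdot_cauchy_schwarz _ _))// expr2 mulrA ler_wpM2r ?hnorm_ge0//.
exact: hnorm_subSM_le.
Qed.

End estimates.

(** * Invertibility of the multiplier *)

Theorem theorem2p4 (R : realType) (d : measure_display) (T : measurableType d)
    (mu : {measure set T -> \bar R})
    (H : hilbertType R) (K : T -> hilbertType R)
    (Lam Theta : forall w, boundedOp H (K w)) (A B nu delta : R) (m : T -> R) :
  continuous_gframe mu A B Lam ->
  (forall f, strongly_measurable (fun w => Theta w f)) ->
  0 <= nu < A ^+ 2 / B ->
  (forall f, (\int[mu]_w (hnorm (Lam w f - Theta w f) ^+ 2)%:E
              <= (nu * hnorm f ^+ 2)%:E)%E) ->
  m \in Lfun mu +oo%E ->
  0 < delta ->
  {ae mu, forall w, delta <= m w} ->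
  let minf := Linfty_norm mu m in
  minf / delta * Num.sqrt nu < A / Num.sqrt B ->
  [/\ exists M, is_multiplier mu m Lam Theta M,
      exists S, is_frame_operator mu (sqrt_weighted m Lam) S &
      forall M S, is_multiplier mu m Lam Theta M ->
        is_frame_operator mu (sqrt_weighted m Lam) S ->
      exists M' S' : boundedOp H H,
        [/\ inverse_op M M', inverse_op S S',
            forall f,
              1 / (minf * B + minf * Num.sqrt (nu * B)) * hnorm f
                <= hnorm (M' f)
                <= 1 / (delta * A - minf * Num.sqrt (nu * B)) * hnorm f,
            opnorm (M' \- neumann_sum S S' M n)%R @[n --> \oo] --> 0%E &
            forall n, (opnorm (M' \- neumann_sum S S' M n)%R
              <= ((minf * Num.sqrt (nu * B) / (delta * A)) ^+ n.+1
                  * (1 / (delta * A - minf * Num.sqrt (nu * B))))%:E)%E]].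
Proof.
move=> frameL mTh /andP[nu0 _] LTh mLoo delta0 mdelta minf small.
have [_ A0 AB _] := frameL.
have B0 : 0 < B by exact: lt_le_trans AB.
have c0 : 0 <= minf by exact: Linfty_norm_ge0.
have mc : {ae mu, forall w, `|m w| <= minf} by exact: Linfty_norm_ae.
pose gap := delta * A - minf * Num.sqrt (nu * B).
have gap0 : 0 < gap.
  move: small; rewrite subr_gt0 (sqrtrM _ nu0) ltr_pdivlMr ?sqrtr_gt0//.
  rewrite -[_ < A](ltr_pM2l delta0); congr (_ < _).
  by field; rewrite gt_eqF.
have dA0 : 0 < delta * A by rewrite mulr_gt0.
have S_coercive := rdot_S_ge frameL delta0 mdelta.
have S_inverse S : is_multiplier mu (fun w => Num.sqrt (m w) ^+ 2) Lam Lam S ->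
    exists S', inverse_op S S' /\ forall f, hnorm (S' f) <= (delta * A)^-1 * hnorm f.
  by move=> SP; apply: lax_milgram dA0 _ => f; exact: S_coercive.
have nc : {ae mu, forall w, `|Num.sqrt (m w) ^+ 2| <= minf}.
  apply: filterS2 mdelta mc => w mw mw'.
  by rewrite sqr_sqrtr// (le_trans (ltW delta0)).
split.
- exact: (gframe_multiplier_exists frameL mTh nu0 LTh c0 mc).
- have [S SP] := multiplier_exists (let: And4 h _ _ _ := frameL in h)
    (bessel_L frameL) (bessel_L frameL) (ltW B0) (ltW B0) c0 nc.
  exists S; split.
  + exact/frame_operator_multiplier.
  + move=> f; rewrite lecE; apply/andP; split => /=; last first.
      by rewrite (le_trans _ (S_coercive S SP f))// mulr_ge0 ?sqr_ge0// ltW.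
    have [_ ->] := SP f f; rewrite /= /Rintegral; apply/eqP.
    rewrite (_ : integral _ _ _ = 0%E)//; apply: integral0_eq => w _; congr EFin.
    by rewrite -norm_inner normr_hnorm -rmorphXn /= mul0r mulr0 addr0.
  + by have [S' [SS' _]] := S_inverse S SP; exists S'.
move=> M S MP [/frame_operator_multiplier SP _ _].
have [S' [SS' S'le]] := S_inverse S SP.
have SMle := hnorm_subSM_le frameL mTh nu0 LTh c0 mc delta0 mdelta SP MP.
have [M' [MM' M'le]] := lax_milgram gap0
  (rdot_M_ge frameL mTh nu0 LTh c0 mc delta0 mdelta SP MP).
pose q := minf * Num.sqrt (nu * B) / (delta * A).
have q0 : 0 <= q by rewrite divr_ge0 ?mulr_ge0// ltW.
have q1 : q < 1 by rewrite ltr_pdivrMr// mul1r -subr_gt0.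
have Ele h : hnorm (S' (S h - M h)) <= q * hnorm h.
  rewrite (le_trans (S'le _))// /q [_ / _]mulrC -mulrA.
  by rewrite ler_wpM2l// invr_ge0 ltW.
have err n : (opnorm (M' \- neumann_sum S S' M n)%R <= (q ^+ n.+1 * (1 / gap))%:E)%E.
  apply: opnorm_le => [|f]; first by rewrite mulr_ge0 ?exprn_ge0// div1r invr_ge0 ltW.
  rewrite /= (neumann_remainder n f SS' MM') (le_trans (hnorm_iter_le _ _ q0 Ele))//.
  by rewrite -mulrA ler_wpM2l ?exprn_ge0// div1r.
exists M', S'; split=> //.
- move=> f; apply/andP; split; last by rewrite div1r.
  have := hnorm_M_le frameL mTh nu0 LTh c0 mc delta0 mdelta SP MP (M' f).
  rewrite MM'.2; set k := _ + _ => fM'f.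
  have : 0 <= k by rewrite addr_ge0 ?mulr_ge0// ltW.
  (* the constant vanishes only on trivial spaces, and then its inverse is 0 *)
  rewrite le0r => /orP[/eqP->|k0]; first by rewrite invr0 mulr0 mul0r hnorm_ge0.
  by rewrite div1r ler_pdivrMl.
- apply: (@squeeze_cvge _ _ _ _ (cst 0%E) _ (fun n => (q ^+ n.+1 * (1 / gap))%:E)).
  + by apply: nearW => n; rewrite opnorm_ge0 err.
  + exact: cvg_cst.
  + apply: cvg_EFin; first by apply: nearW.
    rewrite -[X in _ --> X](mul0r (1 / gap)); apply: cvgM; last exact: cvg_cst.
    rewrite (_ : (fun n => _) = (fun n => (geometric 1 q) (n + 1)%N)).
      rewrite (cvg_shiftn 1).
      by apply: cvg_geometric; rewrite ger0_norm.
    by apply/funext => n; rewrite /geometric /= mul1r addn1.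
Qed.
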